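(* Let $q,\beta>0$ and let $0<\alpha<1$. Let $r\in\mathbb{N}$ and weights $w_1,\dots,w_r\ge0$ with $\sum_{j=1}^r w_j=1$ be given. For every $f\in C_B(\mathbb{R})$ and every $n\in\mathbb{N}$ with $n^{1-\alpha}>2$, put $$E:=\omega\left(f,\frac1n+\frac{1}{n^{\alpha}}\right)+\frac{2\left(q+\frac1q\right)\|f\|_\infty}{e^{\beta(n^{1-\alpha}-1)}}.$$ Then $$|\overline{B_n}(f)(x)-f(x)|\le E\quad\text{for every }x\in\mathbb{R},\qquad\text{and}\qquad \|\overline{B_n}(f)-f\|_\infty\le E.$$ Furthermore, for every $f\in C_{UB}(\mathbb{R})$, $\lim_{n\to\infty}\overline{B_n}(f)=f$ pointwise and uniformly on $\mathbb{R}$.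
   Context: $\mathbb{N}=\{1,2,\dots\}$. For $q,\beta>0$ and $x\in\mathbb{R}$ let $\nu_{q}(x)=\frac{1-qe^{-\beta x}}{1+qe^{-\beta x}}$ and $G_{q,\beta}(x)=\frac14\left(\nu_{q}(x+1)-\nu_{q}(x-1)\right)$; $G_{1/q,\beta}$ is the same with $q$ replaced by $1/q$. Let $\Psi=\frac12\left(G_{q,\beta}+G_{1/q,\beta}\right)$ (an even probability density on $\mathbb{R}$). $C_B(\mathbb{R})$ is the set of continuous bounded real functions on $\mathbb{R}$ and $C_{UB}(\mathbb{R})$ the set of uniformly continuous bounded ones. $\|\cdot\|_\infty$ is the supremum norm on $\mathbb{R}$. For $\theta>0$, $\omega(f,\theta)=\sup\{|f(x)-f(y)|: x,y\in\mathbb{R},\ |x-y|\le\theta\}$. The (quadrature type) operator $\overline{B_n}$ is $$\overline{B_n}(f)(x)=\int_{-\infty}^{\infty}\left(\sum_{j=1}^r w_j f\left(\frac vn+\frac{j}{nr}\right)\right)\Psi(nx-v)\,dv .$$ *)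

(* Defs.v *)
From mathcomp Require Import all_boot all_order all_algebra.
From mathcomp Require Import all_classical all_reals all_analysis.

Set Implicit Arguments.
Unset Strict Implicit.
Unset Printing Implicit Defensive.

Import Order.TTheory GRing.Theory Num.Theory.
Import numFieldNormedType.Exports.

Local Open Scope classical_set_scope.
Local Open Scope ring_scope.

Definition nu (R : realType) (q beta x : R) : R :=
  (1 - q * expR (- (beta * x))) / (1 + q * expR (- (beta * x))).

Definition G (R : realType) (q beta x : R) : R :=
  (nu q beta (x + 1) - nu q beta (x - 1)) / 4.

Definition Psi (R : realType) (q beta x : R) : R :=
  (G q beta x + G q^-1 beta x) / 2.

(* [sup] is real-valued, and is 0 on a set without an upper bound: [supnorm]
   and [modulus] have their usual meaning when the function is bounded. *)
Definition supnorm (R : realType) (f : R -> R) : R :=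
  sup [set `|f x| | x in [set: R]].

Definition modulus (R : realType) (f : R -> R) (theta : R) : R :=
  sup [set d | exists x y : R, `|x - y| <= theta /\ d = `|f x - f y|].

(* Only the values [w 1, ..., w r] of the weight sequence [w] are used. *)
Definition quadrature_op (R : realType) (q beta : R) (r : nat) (w : nat -> R)
    (n : nat) (f : R -> R) (x : R) : R :=
  \int[lebesgue_measure]_v
    ((\sum_(1 <= j < r.+1) w j * f (v / n%:R + j%:R / (n%:R * r%:R))) *
     Psi q beta (n%:R * x - v)).

(* Main.v *)
Require Import Defs.
From mathcomp Require Import all_boot all_order all_algebra.
From mathcomp Require Import all_classical all_reals all_analysis.
From mathcomp Require Import measurable_realfun ring lra.

Set Implicit Arguments.
Unset Strict Implicit.
Unset Printing Implicit Defensive.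

Import Order.TTheory GRing.Theory Num.Theory.
Import numFieldNormedType.Exports.

Local Open Scope classical_set_scope.
Local Open Scope ring_scope.

(** The function [softplus x = (2 / beta) ln (1 + q e^(- beta x))] is a
    primitive of [nu - 1], so [G] has the explicit primitive
    [(softplus (x + 1) - softplus (x - 1)) / 4].  This gives every tail of
    [Psi] in closed form; since [G q (- x) = G q^-1 x], [Psi] is even, hence
    each half line carries mass [1 / 2], and the mass of [|u| >= T] is at most
    [(q + 1 / q) e^(- beta (T - 1))].  As [Psi] has mass 1, the error is the
    integral of the averaged increments of [f] against [Psi (n x - v)]: where
    [|n x - v| <= n^(1 - alpha)] they are bounded by the modulus of continuity
    at [1 / n + 1 / n^alpha], elsewhere by twice the norm of [f] times the
    tail mass. *)

(** * The sigmoid and the kernel: primitive, reflection, sign, continuity *)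

Section kernel.
Variables (R : realType).
Implicit Types (q beta x a c T : R).

(** A primitive of [nu - 1] is preferred to one of [nu] because, for [beta > 0], this one tends to 0
    at [+oo], so that tails need no additive constant. *)
Definition softplus q beta x : R := 2 / beta * ln (1 + q * expR (- (beta * x))).

Lemma denominator_gt0 q beta x : 0 < q -> 0 < 1 + q * expR (- (beta * x)).
Proof. by move=> q0; rewrite addr_gt0// mulr_gt0// expR_gt0. Qed.

Lemma is_derive_softplus q beta x : 0 < q -> beta != 0 ->
  is_derive x 1 (softplus q beta) (nu q beta x - 1).
Proof.
move=> q0 b0; have d0 := denominator_gt0 beta x q0.
have h : is_derive x 1 (fun y => 1 + q * expR (- (beta * y)))
    (- (beta * (q * expR (- (beta * x))))).
  have hlin : is_derive x 1 (fun y => - (beta * y)) (- beta).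
    have -> : (fun y : R => - (beta * y)) = (- beta) \*: id.
      by apply/funext => y; rewrite /= /GRing.scale /= mulNr.
    by apply: is_derive_eq; rewrite /GRing.scale /= mulr1.
  have he := @is_derive1_comp _ expR (fun y => - (beta * y)) x _ _
    (is_derive_expR _) hlin.
  have -> : (fun y => 1 + q * expR (- (beta * y))) =
     cst 1 + (q \*: (expR \o (fun y => - (beta * y)))) by apply/funext.
  by apply: is_derive_eq; rewrite /GRing.scale /=; ring.
have hl := @is_derive1_comp _ (@ln R) (fun y => 1 + q * expR (- (beta * y))) x _ _
  (is_derive1_ln d0) h.
have -> : softplus q beta =
  (2 / beta) \*: (@ln R \o (fun y => 1 + q * expR (- (beta * y)))).
  by apply/funext.
apply: is_derive_eq; rewrite /GRing.scale /= /nu.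
by field; rewrite b0 gt_eqF.
Qed.


(** With a single occurrence of [x], monotonicity can be read off one operation at a time. *)
Lemma nuE q beta x : 0 < q -> nu q beta x = 2 / (1 + q * expR (- (beta * x))) - 1.
Proof.
by move=> q0; have d0 := denominator_gt0 beta x q0; rewrite /nu; field; rewrite gt_eqF.
Qed.

Lemma nuN q beta x : 0 < q -> nu q beta (- x) = - nu q^-1 beta x.
Proof.
move=> q0; have e0 := expR_gt0 (beta * x).
have d0 := denominator_gt0 beta x (q := q^-1).
have d1 : 0 < q * expR (beta * x) + 1 by rewrite addr_gt0// mulr_gt0.
rewrite /nu mulrN opprK expRN.
by field; rewrite !gt_eqF// addrC.
Qed.

Lemma le_nu q beta x y : 0 < q -> 0 < beta -> x <= y ->
  nu q beta x <= nu q beta y.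
Proof.
move=> q0 b0 xy; rewrite !nuE// lerD2r ler_pM2l// lef_pV2 ?posrE ?denominator_gt0//.
by rewrite lerD2l ler_pM2l// ler_expR lerN2 ler_pM2l.
Qed.

Lemma continuous_nu q beta : 0 < q -> continuous (nu q beta).
Proof.
move=> q0 x.
have ce : {for x, continuous (fun y => q * expR (- (beta * y)))}.
  apply: cvgM; first exact: cvg_cst.
  apply: (@continuous_comp _ _ _ (fun y => - (beta * y)) (@expR R)).
    by apply: cvgN; apply: cvgM; [exact: cvg_cst|exact: cvg_id].
  exact: continuous_expR.
apply: cvgM.
  by apply: cvgB => //; exact: cvg_cst.
apply: cvgV; first by rewrite gt_eqF// denominator_gt0.
by apply: cvgD => //; exact: cvg_cst.
Qed.

Lemma GN q beta x : 0 < q -> G q beta (- x) = G q^-1 beta x.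
Proof.
move=> q0; rewrite /G.
have -> : - x + 1 = - (x - 1) by ring.
have -> : - x - 1 = - (x + 1) by ring.
by rewrite !nuN//; ring.
Qed.

Lemma PsiN q beta x : 0 < q -> Psi q beta (- x) = Psi q beta x.
Proof.
by move=> q0; rewrite /Psi !GN ?invr_gt0// invrK addrC.
Qed.

Lemma G_ge0 q beta x : 0 < q -> 0 < beta -> 0 <= G q beta x.
Proof.
by move=> q0 b0; rewrite divr_ge0// subr_ge0 le_nu//; lra.
Qed.

Lemma Psi_ge0 q beta x : 0 < q -> 0 < beta -> 0 <= Psi q beta x.
Proof.
by move=> q0 b0; rewrite divr_ge0// addr_ge0// G_ge0// invr_gt0.
Qed.

Lemma continuous_G q beta : 0 < q -> continuous (G q beta).
Proof.
move=> q0 x; apply: cvgM; last exact: cvg_cst.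
have cs c : {for x, continuous (fun y => nu q beta (y + c))}.
  apply: (@continuous_comp _ _ _ (fun y => y + c) (nu q beta)).
    by apply: cvgD; [exact: cvg_id|exact: cvg_cst].
  exact: continuous_nu.
by apply: cvgB; exact: cs.
Qed.

Lemma continuous_Psi q beta : 0 < q -> continuous (Psi q beta).
Proof.
move=> q0 x; apply: cvgM; last exact: cvg_cst.
by apply: cvgD; apply: continuous_G; rewrite ?invr_gt0.
Qed.

(** * Tails of [G] and [Psi] in closed form *)

Definition G_tail q beta a : R :=
  (softplus q beta (a - 1) - softplus q beta (a + 1)) / 4.

Lemma is_derive_G_tail q beta a : 0 < q -> beta != 0 ->
  is_derive a 1 (G_tail q beta) (- G q beta a).
Proof.
move=> q0 b0.
have h c : is_derive a 1 (fun y => softplus q beta (y + c)) (nu q beta (a + c) - 1).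
  have hc : is_derive a 1 (fun y => y + c) 1 by exact: is_derive_shift.
  have hs := is_derive_softplus (a + c) q0 b0.
  have := @is_derive1_comp _ (softplus q beta) (fun y => y + c) a _ _ hs hc.
  by rewrite mulr1.
have h1 := h 1; have h2 := h (-1).
have -> : G_tail q beta = 4^-1 \*: ((fun y => softplus q beta (y + -1)) -
   (fun y => softplus q beta (y + 1))).
  by apply/funext => y; rewrite /G_tail mulrC.
by apply: is_derive_eq; rewrite /GRing.scale /= /G; field.
Qed.

(** Factor [q e^(beta x)] out of the logarithm. The linear term [- 2 x] is the source of the total
    mass of [G]. *)
Lemma softplus_inv q beta x : 0 < q -> beta != 0 ->
  softplus q^-1 beta x = softplus q beta (- x) - 2 * x - 2 / beta * ln q.
Proof.
move=> q0 b0; rewrite /softplus mulrN opprK.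
have -> : 1 + q^-1 * expR (- (beta * x)) =
    (1 + q * expR (beta * x)) / (q * expR (beta * x)).
  by rewrite expRN; field; rewrite !gt_eqF ?expR_gt0.
have p0 : 0 < q * expR (beta * x) by rewrite mulr_gt0 ?expR_gt0.
rewrite ln_div ?posrE ?addr_gt0//.
rewrite lnM ?posrE ?expR_gt0// expRK.
by field.
Qed.

(** This is the total mass 1 of [G] in algebraic form: by reflection, the right tail at [a] for
    [1 / q] is the left tail at [- a] for [q]. The linear terms of [softplus_inv] differ by 4, which
    the division by 4 turns into 1. *)
Lemma G_tail_inv q beta a : 0 < q -> beta != 0 ->
  G_tail q^-1 beta a = 1 - G_tail q beta (- a).
Proof.
move=> q0 b0; rewrite /G_tail !softplus_inv//.
have -> : - (a - 1) = - a + 1 by ring.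
have -> : - (a + 1) = - a - 1 by ring.
by field.
Qed.

Lemma G_tail_ge0 q beta a : 0 < q -> 0 < beta -> 0 <= G_tail q beta a.
Proof.
move=> q0 b0; rewrite divr_ge0// subr_ge0 ler_pM2l ?divr_gt0//.
rewrite ler_ln ?posrE ?denominator_gt0// lerD2l ler_pM2l// ler_expR lerN2.
by rewrite ler_pM2l//; lra.
Qed.

Lemma G_tail_le q beta a : 0 < q -> 0 < beta ->
  G_tail q beta a <= q * expR (- (beta * (a - 1))).
Proof.
move=> q0 b0; rewrite /G_tail /softplus.
set u := q * expR (- (beta * (a - 1))).
have u0 : 0 < u by rewrite mulr_gt0 ?expR_gt0.
have -> : q * expR (- (beta * (a + 1))) = u * expR (- (2 * beta)).
  by rewrite /u -mulrA -expRD; congr (q * expR _); ring.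
set t := expR (- (2 * beta)).
have t0 : 0 < t by exact: expR_gt0.
have ut0 : 0 < 1 + u * t by rewrite addr_gt0// mulr_gt0.
suff : ln (1 + u) - ln (1 + u * t) <= 2 * beta * u.
  move=> h; rewrite -mulrBr.
  have -> : 2 / beta * (ln (1 + u) - ln (1 + u * t)) / 4 =
    (ln (1 + u) - ln (1 + u * t)) / (2 * beta) by field; rewrite gt_eqF.
  have p : 0 < 2 * beta by rewrite mulr_gt0.
  by rewrite ler_pdivrMr// (mulrC u (2 * beta)).
have u1 : 0 < 1 + u by rewrite addr_gt0.
(* [1 + u <= (1 + 2 beta u) (1 + u t)], as [t >= 1 - 2 beta]: comparing the two
   logarithms, rather than dropping the second, avoids a factor [1 / beta]. *)
rewrite lerBlDr -ler_expR expRD !lnK ?posrE//.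
have e1 := expR_ge1Dx (2 * beta * u).
have e2 := expR_ge1Dx (- (2 * beta)); rewrite -/t in e2.
apply: (@le_trans _ _ ((1 + 2 * beta * u) * (1 + u * t))); last by rewrite ler_pM2r.
(* The difference of the two sides is exactly the sum of these two nonnegative terms. *)
have h1 : 0 <= 2 * beta * u * (u * t) by rewrite !mulr_ge0// ltW.
have h2 : 0 <= u * (t - 1 + 2 * beta) by rewrite mulr_ge0//; [exact: ltW|lra].
by lra.
Qed.

Definition Psi_tail q beta a : R := (G_tail q beta a + G_tail q^-1 beta a) / 2.

Lemma is_derive_Psi_tail q beta a : 0 < q -> beta != 0 ->
  is_derive a 1 (Psi_tail q beta) (- Psi q beta a).
Proof.
move=> q0 b0; have qV0 : 0 < q^-1 by rewrite invr_gt0.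
have h1 := is_derive_G_tail a q0 b0; have h2 := is_derive_G_tail a qV0 b0.
have -> : Psi_tail q beta = 2^-1 \*: (G_tail q beta + G_tail q^-1 beta).
  by apply/funext => y; rewrite /Psi_tail mulrC.
by apply: is_derive_eq; rewrite /GRing.scale /= /Psi; field.
Qed.

Lemma Psi_tail0 q beta : 0 < q -> beta != 0 -> Psi_tail q beta 0 = 1 / 2.
Proof. by move=> q0 b0; rewrite /Psi_tail G_tail_inv// oppr0; field. Qed.

Lemma Psi_tail_ge0 q beta a : 0 < q -> 0 < beta -> 0 <= Psi_tail q beta a.
Proof.
by move=> q0 b0; rewrite divr_ge0// addr_ge0// G_tail_ge0// invr_gt0.
Qed.

Lemma Psi_tail_le q beta a : 0 < q -> 0 < beta ->
  Psi_tail q beta a <= (q + 1 / q) / 2 * expR (- (beta * (a - 1))).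
Proof.
move=> q0 b0; have qV0 : 0 < q^-1 by rewrite invr_gt0.
have h1 := G_tail_le a q0 b0; have h2 := G_tail_le a qV0 b0.
by rewrite /Psi_tail; lra.
Qed.

(** This limit fixes the constant of integration: it makes [Psi_tail] the integral over a right half
    line, not merely a primitive up to sign. *)
Lemma cvg_Psi_tail q beta : 0 < q -> 0 < beta ->
  Psi_tail q beta a @[a --> +oo] --> 0.
Proof.
move=> q0 b0.
apply: (@squeeze_cvgr _ _ _ _ (cst 0)
   (fun a => (q + 1 / q) / 2 * expR (- (beta * (a - 1))))).
- by near=> a; rewrite Psi_tail_ge0//= Psi_tail_le.
- exact: cvg_cst.
- rewrite -[X in _ --> X](mulr0 ((q + 1 / q) / 2)); apply: cvgMr.
  apply: (@cvg_comp _ _ _ (fun a => beta * (a - 1)) (fun y => expR (- y)) _ +oo);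
    last exact: cvgr_expR.
  apply/cvgryPge => A; near=> a.
  rewrite -ler_pdivrMl// lerBrDr.
  by near: a; apply: nbhs_pinfty_ge; exact: num_real.
Unshelve. all: by end_near. Qed.


(** * Integration against the kernel *)

Local Notation mu := (@lebesgue_measure R).

Lemma continuous_Psi_sub q beta c : 0 < q -> continuous (fun v => Psi q beta (c - v)).
Proof.
move=> q0 v; apply: (@continuous_comp _ _ _ (fun v => c - v) (Psi q beta)).
  by apply: cvgB; [exact: cvg_cst|exact: cvg_id].
exact: continuous_Psi.
Qed.

Lemma measurable_Psi_sub q beta c (D : set R) : 0 < q ->
  measurable_fun D (EFin \o (fun v : R => Psi q beta (c - v))).
Proof.
move=> q0; apply/measurable_EFinP/measurable_funTS.
apply: continuous_measurable_fun; exact: continuous_Psi_sub.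
Qed.

(** The fundamental theorem of calculus on a half line, with primitive [- Psi_tail (v - c)]; its
    derivative is [Psi (v - c)], which evenness turns into [Psi (c - v)]. *)
Lemma integral_Psi_itvy q beta a c : 0 < q -> 0 < beta ->
  (\int[mu]_(v in `[a, +oo[) (Psi q beta (c - v))%:E = (Psi_tail q beta (a - c))%:E)%E.
Proof.
move=> q0 b0; have bn0 : beta != 0 by rewrite gt_eqF.
have dF x : is_derive x 1 (fun v => - Psi_tail q beta (v - c)) (Psi q beta (c - x)).
  have hc : is_derive x 1 (fun y => y - c) 1 by exact: is_derive_shift x 1 (- c).
  have h := @is_derive1_comp _ (Psi_tail q beta) (fun y => y - c) x _ _
    (is_derive_Psi_tail (x - c) q0 bn0) hc.
  have -> : (fun v => - Psi_tail q beta (v - c)) = - (Psi_tail q beta \o (fun y => y - c)).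
    by apply/funext.
  by apply: is_derive_eq; rewrite mulr1 opprK -PsiN// opprB.
have cF x : {for x, continuous (fun v => - Psi_tail q beta (v - c))}.
  by apply/differentiable_continuous/derivable1_diffP; apply: ex_derive.
rewrite (@ge0_continuous_FTC2y _ _ (fun v => - Psi_tail q beta (v - c)) _ 0).
- by rewrite -EFinB sub0r opprK.
- by move=> x _; exact: Psi_ge0.
- by apply: continuous_subspaceT; exact: continuous_Psi_sub.
- rewrite -oppr0; apply: cvgN.
  apply: (@cvg_comp _ _ _ (fun v => v - c) (Psi_tail q beta) _ +oo);
    last exact: cvg_Psi_tail.
  apply/cvgryPge => A; near=> v; rewrite lerBrDr.
  by near: v; apply: nbhs_pinfty_ge; exact: num_real.
- by move=> x _; apply: ex_derive.
- exact: cvg_at_right_filter (cF a).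
- by move=> x _; rewrite derive1E derive_val.
Unshelve. all: by end_near. Qed.

(** The substitution of [- v] for [v], with evenness, reduces this to the right half line from [- a]
    and the centre [- c]. *)
Lemma integral_Psi_itvNy q beta a c : 0 < q -> 0 < beta ->
  (\int[mu]_(v in `]-oo, a]) (Psi q beta (c - v))%:E = (Psi_tail q beta (c - a))%:E)%E.
Proof.
move=> q0 b0.
rewrite -[in LHS](opprK a).
rewrite (@ge0_integration_by_substitutionNy _ (fun v => Psi q beta (c - v))).
- have -> : c - a = - a - (- c) by ring.
  rewrite -integral_Psi_itvy//; apply: eq_integral => v _ /=.
  by rewrite -PsiN//; congr (Psi _ _ _)%:E; ring.
- by apply: continuous_subspaceT; exact: continuous_Psi_sub.
- by move=> v _; exact: Psi_ge0.
Qed.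

Lemma integral_Psi q beta c : 0 < q -> 0 < beta ->
  (\int[mu]_v (Psi q beta (c - v))%:E = 1)%E.
Proof.
move=> q0 b0; have bn0 : beta != 0 by rewrite gt_eqF.
rewrite -(setUv `]-oo, c]%classic) ge0_integral_setU//=.
- rewrite setCitvl integral_itv_obnd_cbnd; last exact: measurable_Psi_sub.
  rewrite integral_Psi_itvNy// integral_Psi_itvy// subrr Psi_tail0//.
  by rewrite -EFinD; congr (_%:E); field.
- exact: measurableC.
- exact: measurable_Psi_sub.
- by move=> x _; rewrite lee_fin Psi_ge0.
- exact/disj_setPCl.
Qed.

(** Each half line contributes [Psi_tail T], at most half of the bound; [0 < T] makes them
    disjoint. *)
Lemma integral_Psi_far_le q beta c T : 0 < q -> 0 < beta -> 0 < T ->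
  (\int[mu]_(v in `]-oo, (c - T)%R] `|` `[(c + T)%R, +oo[) (Psi q beta (c - v))%:E <=
   ((q + 1 / q) * expR (- (beta * (T - 1))))%:E)%E.
Proof.
move=> q0 b0 T0; rewrite ge0_integral_setU//=.
- rewrite integral_Psi_itvNy// integral_Psi_itvy//.
  have -> : c - (c - T) = T by ring.
  have -> : c + T - c = T by ring.
  by rewrite -EFinD lee_fin; have := Psi_tail_le T q0 b0; lra.
- exact: measurable_Psi_sub.
- by move=> x _; rewrite lee_fin Psi_ge0.
- apply/disj_setPS => v [] /=; rewrite !in_itv/= andbT => h1 h2.
  by lra.
Qed.

Lemma integrable_Psi q beta c : 0 < q -> 0 < beta ->
  mu.-integrable setT (EFin \o (fun v : R => Psi q beta (c - v))).
Proof.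
move=> q0 b0; apply/integrableP; split; first exact: measurable_Psi_sub.
rewrite (_ : \int[mu]_x _ = 1)%E ?ltry//.
rewrite -(integral_Psi c q0 b0); apply: eq_integral => v _ /=.
by rewrite ger0_norm// Psi_ge0.
Qed.

Lemma integrable_mul_Psi q beta c (D : R -> R) M : 0 < q -> 0 < beta ->
  continuous D -> (forall v, `|D v| <= M) ->
  mu.-integrable setT (EFin \o (fun v : R => D v * Psi q beta (c - v))).
Proof.
move=> q0 b0 cD DM.
have mD : measurable_fun setT D by exact: continuous_measurable_fun.
apply: (@integrableMr _ _ _ mu setT measurableT D _ mD _ (integrable_Psi c q0 b0)).
exists M; split; first exact: num_real.
by move=> x Mx v _; exact: le_trans (DM v) (ltW Mx).
Qed.

(** Instead of splitting the domain, the integrand is dominated everywhere by [omega Psi] plus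
    [M Psi] restricted to the far set [A]; the first term integrates to [omega] by total mass 1, the
    second is a tail. *)
Lemma integral_mul_Psi_le q beta c T (omega M : R) (D : R -> R) :
  0 < q -> 0 < beta -> continuous D -> 0 <= M ->
  (forall v, `|D v| <= M) ->
  (forall v, `|v - c| <= T -> `|D v| <= omega) -> 0 <= omega -> 0 < T ->
  `|\int[mu]_v (D v * Psi q beta (c - v))| <=
    omega + M * ((q + 1 / q) * expR (- (beta * (T - 1)))).
Proof.
move=> q0 b0 cD M0 DM Domega omega0 T0.
set A := `]-oo, c - T]%classic `|` `[c + T, +oo[%classic.
have mA : measurable A by apply: measurableU.
have mD : measurable_fun setT D by exact: continuous_measurable_fun.
have mP : measurable_fun setT (fun v : R => Psi q beta (c - v)).
  by apply: continuous_measurable_fun; exact: continuous_Psi_sub.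
have mPA : measurable_fun setT ((EFin \o (fun v : R => Psi q beta (c - v))) \_ A).
  by apply/(measurable_restrictT _ _).1 => //; exact: measurable_Psi_sub.
have iDP := integrable_mul_Psi c q0 b0 cD DM.
rewrite -lee_fin EFin_normr_Rintegral//.
apply: (le_trans (le_abse_integral _ _ _)) => //.
  by apply/measurable_EFinP; apply: measurable_funM.
apply: (@le_trans _ _ (\int[mu]_v (omega%:E * (Psi q beta (c - v))%:E +
   M%:E * ((EFin \o (fun v : R => Psi q beta (c - v))) \_ A) v))%E).
  apply: ge0_le_integral => //.
  - by apply/measurableT_comp => //; apply/measurable_EFinP; apply: measurable_funM.
  - by apply: emeasurable_funD; apply: measurable_funeM => //; apply/measurable_EFinP.
  - move=> v _; rewrite abse_EFin normrM (ger0_norm (Psi_ge0 _ _ _))// patchE.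
    (* On [A] the term in [M] suffices, as [omega] is nonnegative; off [A] one has [|v - c| < T], so
       the term in [omega] does. *)
    case: ifPn => vA.
      rewrite -!EFinM -EFinD lee_fin -mulrDl ler_wpM2r ?Psi_ge0//.
      by rewrite (le_trans (DM v))// lerDr.
    rewrite mule0 adde0 -EFinM lee_fin ler_wpM2r ?Psi_ge0// Domega//.
    move: vA; rewrite notin_setE /A /= !in_itv/= andbT => /not_orP[].
    by move=> /negP h1 /negP h2; rewrite ler_distl; lra.
rewrite ge0_integralD//; last 4 first.
  - by move=> v _; rewrite mule_ge0 ?lee_fin// Psi_ge0.
  - by apply: measurable_funeM => //; apply/measurable_EFinP.
  - move=> v _; rewrite mule_ge0 ?lee_fin//; apply: erestrict_ge0 => x _.
    by rewrite lee_fin Psi_ge0.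
  - by apply: measurable_funeM.
rewrite !ge0_integralZl//; last 3 first.
  - by move=> v _; apply: erestrict_ge0 => x _; rewrite lee_fin Psi_ge0.
  - exact/measurable_EFinP.
  - by move=> v _; rewrite lee_fin Psi_ge0.
rewrite integral_Psi// mule1 -integral_mkcond EFinD leeD2l// EFinM lee_wpmul2l ?lee_fin//.
exact: integral_Psi_far_le.
Qed.


Lemma Rintegral_Psi q beta c : 0 < q -> 0 < beta ->
  \int[mu]_v (Psi q beta (c - v)) = 1.
Proof. by move=> q0 b0; rewrite /Rintegral integral_Psi. Qed.

End kernel.

(** * Supremum norm and modulus of continuity *)

Section modulus.
Variable R : realType.
Implicit Types (f : R -> R) (x y theta : R).

Lemma le_supnorm f x : bounded_fun f -> `|f x| <= supnorm f.
Proof.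
move=> [M [_ hM]]; apply: ub_le_sup; last by exists x.
(* [bounded_fun] provides a bound by every number strictly above [M], hence [M + 1]. *)
by exists (M + 1) => _ [y _ <-]; apply: hM => //; rewrite ltrDl.
Qed.

Lemma le_modulus f theta x y : bounded_fun f -> `|x - y| <= theta ->
  `|f x - f y| <= modulus f theta.
Proof.
move=> bf xy; apply: ub_le_sup; last by exists x, y.
(* An upper bound of the increments keeps [sup] from taking its default value 0. *)
exists (supnorm f + supnorm f) => _ [u [v [_ ->]]].
by rewrite (le_trans (ler_normB _ _))// lerD// le_supnorm.
Qed.

Lemma modulus_ge0 f theta : bounded_fun f -> 0 <= theta -> 0 <= modulus f theta.
Proof.
move=> bf t0; apply: le_trans (@le_modulus f theta 0 0 bf _); first exact: normr_ge0.
by rewrite subrr normr0.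
Qed.

Lemma modulus_le f theta e : 0 <= theta ->
  (forall x y, `|x - y| <= theta -> `|f x - f y| <= e) -> modulus f theta <= e.
Proof.
move=> t0 fe; apply: ge_sup; last by move=> _ [x [y [xy ->]]]; exact: fe.
(* The set of increments is nonempty: as [0 <= theta], it contains that of the pair [(0, 0)]. *)
by exists `|f 0 - f 0|, 0, 0; rewrite subrr normr0.
Qed.

End modulus.

(** * Error of the quadrature operator at a point *)

Section quadrature.
Variables (R : realType) (q beta : R) (r : nat) (w : nat -> R).
Hypotheses (q0 : 0 < q) (beta0 : 0 < beta).
Hypothesis w_ge0 : forall j : nat, (1 <= j <= r)%N -> 0 <= w j.
Hypothesis w_sum1 : \sum_(1 <= j < r.+1) w j = 1.

(** Since the weights sum to 1, [y] is its own weighted average and can be moved inside the sum. It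
    serves below with [y = 0], to bound the averages, and with [y = f x], to bound their
    increments. *)
Lemma dist_wsum_le (g : nat -> R) y e :
  (forall j, (1 <= j <= r)%N -> `|g j - y| <= e) ->
  `|\sum_(1 <= j < r.+1) w j * g j - y| <= e.
Proof.
move=> ge.
have -> : \sum_(1 <= j < r.+1) w j * g j - y =
    \sum_(1 <= j < r.+1) w j * (g j - y).
  rewrite -[y in LHS]mul1r -w_sum1 mulr_suml -sumrB.
  by apply: eq_bigr => j _; rewrite mulrBr.
apply: (le_trans (ler_norm_sum _ _ _)).
rewrite -[leRHS]mul1r -w_sum1 mulr_suml.
rewrite [leLHS]big_nat_cond [leRHS]big_nat_cond; apply: ler_sum => j.
rewrite andbT ltnS => jr; rewrite normrM ger0_norm ?w_ge0// ler_wpM2l ?w_ge0//.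
exact: ge.
Qed.

(** The cut-off [T] between near and far [v] is left free here; the value [n^(1 - alpha)] is chosen
    in the theorem. *)
Lemma dist_quadrature_op_le (f : R -> R) (n : nat) (T x : R) :
  continuous f -> bounded_fun f -> (0 < n)%N -> 0 < T ->
  `|quadrature_op q beta r w n f x - f x| <=
  modulus f (1 / n%:R + T / n%:R) +
    2 * (q + 1 / q) * supnorm f / expR (beta * (T - 1)).
Proof.
move=> cf bf n0 T0.
have n0R : 0 < n%:R :> R by rewrite ltr0n.
have T1 : 0 <= 1 / n%:R + T / n%:R by rewrite addr_ge0// divr_ge0// ltW.
set N := supnorm f.
have fN y : `|f y| <= N by exact: le_supnorm.
have N0 : 0 <= N := le_trans (normr_ge0 _) (fN 0).
pose S v := \sum_(1 <= j < r.+1) w j * f (v / n%:R + j%:R / (n%:R * r%:R)).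
have cS : continuous S.
  apply: continuous_big => [|j _ v]; first exact: add_continuous.
  have cj : {for v, continuous (fun u : R => f (u / n%:R + j%:R / (n%:R * r%:R)))}.
    apply: (@continuous_comp _ _ _ (fun u : R => u / n%:R + j%:R / (n%:R * r%:R)) f).
      by apply: cvgD; [apply: cvgM; [exact: cvg_id|exact: cvg_cst]|exact: cvg_cst].
    exact: cf.
  by apply: cvgM; [exact: cvg_cst|exact: cj].
have SN v : `|S v| <= N.
  by rewrite -[S v]subr0; apply: dist_wsum_le => j _; rewrite subr0.
have cD : continuous (fun v => S v - f x).
  by move=> v; apply: cvgB; [exact: cS|exact: cvg_cst].
have DN v : `|S v - f x| <= 2 * N.
  by rewrite (le_trans (ler_normB _ _))// mulr_natl mulr2n lerD.
have Dmod v : `|v - n%:R * x| <= T ->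
    `|S v - f x| <= modulus f (1 / n%:R + T / n%:R).
  move=> vT; apply: dist_wsum_le => j /andP[j1 jr]; apply: le_modulus => //.
  have r0 : 0 < r%:R :> R by rewrite ltr0n (leq_trans j1).
  (* The node shift is at most [1 / n] because [j <= r], and the remaining displacement is at most
     [T / n]. *)
  have -> : v / n%:R + j%:R / (n%:R * r%:R) - x =
      j%:R / r%:R / n%:R + (v - n%:R * x) / n%:R.
    by field; rewrite !gt_eqF.
  rewrite (le_trans (ler_normD _ _))// lerD//.
    rewrite ger0_norm ?divr_ge0// ler_pM2r ?invr_gt0//.
    by rewrite ler_pdivrMr// mul1r ler_nat.
  by rewrite normrM [`|n%:R^-1|]ger0_norm ?invr_ge0 ?ler0n// ler_pM2r ?invr_gt0.
(* Total mass 1 lets [f x] be written as the integral of [f x * Psi (n x - v)]. *)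
have -> : quadrature_op q beta r w n f x - f x =
    \int[lebesgue_measure]_v ((S v - f x) * Psi q beta (n%:R * x - v)).
  under eq_Rintegral do rewrite mulrBl.
  rewrite RintegralB//.
  - by rewrite RintegralZl// ?Rintegral_Psi ?mulr1//; exact: integrable_Psi.
  - exact: integrable_mul_Psi cS SN.
  - by apply: (@integrable_mul_Psi _ _ _ _ (cst (f x)) `|f x|) => //; exact: cst_continuous.
have -> : 2 * (q + 1 / q) * N / expR (beta * (T - 1)) =
    2 * N * ((q + 1 / q) * expR (- (beta * (T - 1)))).
  by rewrite expRN; ring.
apply: integral_mul_Psi_le => //; first by rewrite mulr_ge0.
exact: modulus_ge0.
Qed.

End quadrature.

(** * Growth of powers, uniform continuity, and the final estimates *)

Lemma near_powR_ge (R : realType) (a A : R) : 0 < a ->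
  \forall n \near \oo, A <= n%:R `^ a.
Proof.
move=> a0; pose B := Num.max A 0.
have B0 : 0 <= B by rewrite le_max lexx orbT.
near=> n; apply: (@le_trans _ _ B); first by rewrite le_max lexx.
(* The root inverts the power on nonnegative numbers, whence the maximum with 0 in [B]. *)
have -> : B = (B `^ a^-1) `^ a by rewrite -powRrM mulVf ?gt_eqF// powRr1.
apply: ge0_ler_powR; rewrite ?nnegrE ?powR_ge0 ?ler0n//; first exact: ltW.
by near: n; exact: nbhs_infty_ger.
Unshelve. all: by end_near. Qed.

Lemma unif_continuous_dist (R : realType) (f : R -> R) e : unif_continuous f ->
  0 < e -> exists2 d, 0 < d & forall x y, `|x - y| < d -> `|f x - f y| < e.
Proof.
move=> uf e0.
have /uf : entourage [set xy : R * R | ball xy.1 e xy.2].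
  by rewrite -entourage_ballE; exists e.
rewrite /= nbhs_simpl/= -entourage_ballE => -[d /= d0 hd].
by exists d => // x y xy; apply: (hd (x, y)).
Qed.

Theorem theorem4 (R : realType) (q beta alpha : R)
  (hq : 0 < q) (hbeta : 0 < beta) (halpha0 : 0 < alpha) (halpha1 : alpha < 1)
  (r : nat) (hr : (0 < r)%N) (w : nat -> R)
  (hw : forall j : nat, (1 <= j <= r)%N -> 0 <= w j)
  (hw1 : \sum_(1 <= j < r.+1) w j = 1) :
  (forall f : R -> R, continuous f -> bounded_fun f ->
   forall n : nat, (0 < n)%N -> 2 < n%:R `^ (1 - alpha) ->
   let E := modulus f (1 / n%:R + 1 / n%:R `^ alpha) +
            2 * (q + 1 / q) * supnorm f /
              expR (beta * (n%:R `^ (1 - alpha) - 1)) in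
   (forall x : R, `|quadrature_op q beta r w n f x - f x| <= E) /\
   supnorm (fun x => quadrature_op q beta r w n f x - f x) <= E) /\
  (forall f : R -> R, unif_continuous f -> bounded_fun f ->
   (forall x : R, quadrature_op q beta r w n f x @[n --> \oo] --> f x) /\
   {uniform, quadrature_op q beta r w n f @[n --> \oo] --> f}).
Proof.

have dist f n x : continuous f -> bounded_fun f -> (0 < n)%N ->
    `|quadrature_op q beta r w n f x - f x| <=
    modulus f (1 / n%:R + 1 / n%:R `^ alpha) +
            2 * (q + 1 / q) * supnorm f /
              expR (beta * (n%:R `^ (1 - alpha) - 1)).
  move=> cf bf n0; have n0R : 0 < n%:R :> R by rewrite ltr0n.
  (* This exhibits the cut-off [T = n^(1 - alpha)]. *)
  have -> : 1 / n%:R `^ alpha = n%:R `^ (1 - alpha) / n%:R.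
    rewrite powRB ?gt_eqF// powRr1//.
    by field; rewrite !gt_eqF// powR_gt0.
  by apply: dist_quadrature_op_le => //; exact: powR_gt0.
split=> [f cf bf n n0 _ E|f uf bf].
  have BE x : `|quadrature_op q beta r w n f x - f x| <= E by exact: dist.
  split=> //; apply: ge_sup => [|_ [x _ <-] //].
  by exists `|quadrature_op q beta r w n f 0 - f 0|, 0.
have cf : continuous f.
  move=> x; apply/cvgrPdist_lt => e e0.
  have [d d0 fd] := unif_continuous_dist uf e0.
  by near=> y; apply: fd; near: y; exact: (nbhsx_ballx x d d0).
(* The threshold on [n] does not depend on [x], so both limits follow from this. The error is split
   as [e / 4] for the modulus and [e / 2] for the tail. *)
have unif e : 0 < e -> \forall n \near \oo, forall x,
    `|quadrature_op q beta r w n f x - f x| < e.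
  move=> e0; have e20 : 0 < e / 2 by rewrite divr_gt0.
  have e40 : 0 < e / 4 by rewrite divr_gt0.
  have [d d0 fd] := unif_continuous_dist uf e40.
  set K := 2 * (q + 1 / q) * supnorm f.
  have a10 : 0 < 1 - alpha by rewrite subr_gt0.
  near=> n => x.
  have n0 : (0 < n)%N by near: n; exact: nbhs_infty_gt.
  have n0R : 0 < n%:R :> R by rewrite ltr0n.
  have na0 : 0 < n%:R `^ alpha by exact: powR_gt0.
  (* [n1] and [n2] make [1 / n] and [1 / n^alpha] at most [d / 4] each, so their sum stays strictly
     below [d]. *)
  have n1 : 4 / d <= n%:R by near: n; exact: nbhs_infty_ger.
  have n2 : 4 / d <= n%:R `^ alpha by near: n; exact: near_powR_ge.
  (* Chosen so that [beta (n^(1 - alpha) - 1)] is at least [K / (e / 2)]; as [1 + y <= e^y], the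
     exponential then exceeds that quotient too. *)
  have n3 : K / (e / 2) / beta + 1 <= n%:R `^ (1 - alpha).
    by near: n; exact: near_powR_ge.
  have d4 t : 0 < t -> 4 / d <= t -> 1 / t <= d / 4.
    move=> t0; rewrite ler_pdivrMr// ler_pdivrMr// => h.
    by rewrite mulrC mulrA ler_pdivlMr//; lra.
  apply: (le_lt_trans (dist f n x cf bf n0)).
  apply: (@le_lt_trans _ _ (e / 4 + e / 2)); last by lra.
  apply: lerD.
    apply: modulus_le; first by rewrite addr_ge0// divr_ge0// ltW.
    move=> u v uv; apply/ltW/fd/(le_lt_trans uv).
    by have := d4 _ n0R n1; have := d4 _ na0 n2; lra.
  rewrite -/K ler_pdivrMr ?expR_gt0//.
  rewrite -ler_pdivrMl//.
  have h : K / (e / 2) <= beta * (n%:R `^ (1 - alpha) - 1).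
    by rewrite -(ler_pdivrMl _ _ hbeta) [beta^-1 * _]mulrC lerBrDr.
  rewrite mulrC (le_trans h)// (le_trans _ (expR_ge1Dx _))//; lra.
split=> [x|].
  apply/cvgrPdist_lt => e e0; near=> n; rewrite distrC.
  move: x; near: n; exact: unif.
(* A uniform neighbourhood of [f] is given by an entourage [A], which contains all pairs at distance
   less than some [e]. *)
move=> P /uniform_nbhs[A [+ AP]]; rewrite -entourage_ballE => -[e /= e0 eA].
have := unif e e0; apply: filterS => n Hn; apply: AP => y _; apply: eA.
by rewrite /= -ball_normE /= distrC.
Unshelve. all: by end_near. Qed.
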